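(* Let $\mathbf L$ be a sup-semilattice. Let $\mathbb J$ denote the category of frames and frame homomorphisms and $F\text{-}\mathbb S_{\leq}$ the category of $F$-sup-semilattices and lax morphisms. Then: (a) For an arbitrary frame $\mathbf J=(T,S)$ there exists a unique homomorphism of frames $\nu_{\mathbf J}\colon\mathbf J\to\mathbf J[\mathbf L^{\mathbf J},\mathbf L]$ defined for arbitrary $x\in L^T$ and $i\in T$ by $(\nu_{\mathbf J}(i))(x)=x(i)$. Moreover, $\nu=(\nu_{\mathbf J})_{\mathbf J\in\mathbb J}$ is a natural transformation from the identity functor on $\mathbb J$ to the endofunctor $\mathbf J[\mathbf L^{-},\mathbf L]$. (b) For an arbitrary $F$-sup-semilattice $\mathbf H=(\mathbf G,F)$ there exists a lax morphism of $F$-sup-semilattices $\mu_{\mathbf H}\colon\mathbf H\to\mathbf L^{\mathbf J[\mathbf H,\mathbf L]}$ defined for arbitrary $x\in G$ and $\alpha\in T_{[\mathbf H,\mathbf L]}$ by $(\mu_{\mathbf H}(x))(\alpha)=\alpha(x)$. Moreover, $\mu=(\mu_{\mathbf H})_{\mathbf H\in F\text{-}\mathbb S_{\leq}}$ is a natural transformation from the identity functor on $F\text{-}\mathbb S_{\leq}$ to the endofunctor $\mathbf L^{\mathbf J[-,\mathbf L]}$. (c) There is an adjoint situation between $\mathbb J$ and $(F\text{-}\mathbb S_{\leq})^{\mathrm{op}}$ given by $(\nu,\mu)$: the functor $\mathbf L^{-}\colon\mathbb J\to(F\text{-}\mathbb S_{\leq})^{\mathrm{op}}$ is left adjoint to the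 functor $\mathbf J[-,\mathbf L]\colon(F\text{-}\mathbb S_{\leq})^{\mathrm{op}}\to\mathbb J$, with unit $\nu$ and with counit given by $\mu$ (each $\mu_{\mathbf H}$ being regarded as a morphism $\mathbf L^{\mathbf J[\mathbf H,\mathbf L]}\to\mathbf H$ in $(F\text{-}\mathbb S_{\leq})^{\mathrm{op}}$).
   Context: A sup-semilattice is a poset in which every subset has a join; morphisms of sup-semilattices are maps preserving arbitrary joins. An $F$-sup-semilattice is a pair $(\mathbf G,F)$ where $\mathbf G$ is a sup-semilattice and $F\colon G\to G$ preserves arbitrary joins. A lax morphism of $F$-sup-semilattices $(\mathbf G_1,F_1)\to(\mathbf G_2,F_2)$ is a sup-semilattice morphism $f$ with $F_2(f(x))\leq f(F_1(x))$ for all $x\in G_1$. A frame $\mathbf J=(T,S)$ is a set $T$ with a binary relation $S\subseteq T^2$; a homomorphism of frames $(T_1,S_1)\to(T_2,S_2)$ is a map $t\colon T_1\to T_2$ such that $(i,j)\in S_1$ implies $(t(i),t(j))\in S_2$. Contravariant functor $\mathbf L^{-}$ from $\mathbb J$ to $F\text{-}\mathbb S_{\leq}$: for a frame $\mathbf J=(T,S)$, $\mathbf L^{\mathbf J}=(\mathbf L^T,F^{\mathbf J})$, where $\mathbf L^T$ is the set of maps $T\to L$ with pointwise order and $(F^{\mathbf J}(x))(i)=\bigvee\{x(k)\mid(i,k)\in S\}$; for a frame homomorphism $t\colon\mathbf J_1\to\mathbf J_2$, $\mathbf L^t\colon\mathbf L^{\mathbf J_2}\to\mathbf L^{\mathbf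 J_1}$ is $\mathbf L^t(x)=x\circ t$. Contravariant functor $\mathbf J[-,\mathbf L]$ from $F\text{-}\mathbb S_{\leq}$ to $\mathbb J$: for $\mathbf H=(\mathbf G,F)$, the frame $\mathbf J[\mathbf H,\mathbf L]=(T_{[\mathbf H,\mathbf L]},S_{[\mathbf H,\mathbf L]})$ has $T_{[\mathbf H,\mathbf L]}$ equal to the set of all sup-semilattice morphisms $\mathbf G\to\mathbf L$, and $(\alpha,\beta)\in S_{[\mathbf H,\mathbf L]}$ iff $\beta(x)\leq\alpha(F(x))$ for all $x\in G$; for a lax morphism $f\colon\mathbf H_1\to\mathbf H_2$, $\mathbf J[f,\mathbf L]\colon\mathbf J[\mathbf H_2,\mathbf L]\to\mathbf J[\mathbf H_1,\mathbf L]$ is $\alpha\mapsto\alpha\circ f$. *)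

(* Defs.v *)
From HB Require Import structures.
From mathcomp Require Import all_boot all_order.
From mathcomp Require Import boolp classical_sets.

Set Implicit Arguments.
Unset Strict Implicit.
Unset Printing Implicit Defensive.

Import Order.TTheory.
Local Open Scope classical_set_scope.
Local Open Scope order_scope.

Record category := Category {
  obj :> Type ;
  hom : obj -> obj -> Type ;
  idm : forall X, hom X X ;
  comp : forall X Y Z, hom Y Z -> hom X Y -> hom X Z ;
  comp1m : forall X Y (f : hom X Y), comp (idm Y) f = f ;
  compm1 : forall X Y (f : hom X Y), comp f (idm X) = f ;
  compA : forall X Y Z W (h : hom Z W) (g : hom Y Z) (f : hom X Y),
    comp h (comp g f) = comp (comp h g) f }.

Arguments idm {c} X.
Arguments comp {c X Y Z} _ _.

Definition op (C : category) : category :=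
  @Category C (fun X Y => hom Y X) (fun X => idm X)
    (fun X Y Z g f => comp f g)
    (fun X Y f => compm1 f) (fun X Y f => comp1m f)
    (fun X Y Z W h g f => esym (compA f g h)).

Record functor (C D : category) := Functor {
  fobj :> C -> D ;
  fmap : forall X Y, hom X Y -> hom (fobj X) (fobj Y) ;
  fmap1 : forall X, fmap (idm X) = idm (fobj X) ;
  fmapM : forall X Y Z (g : hom Y Z) (f : hom X Y),
    fmap (comp g f) = comp (fmap g) (fmap f) }.

Arguments fmap {C D} _ [X Y] _.

Definition id_functor (C : category) : functor C C :=
  @Functor C C id (fun X Y f => f) (fun X => erefl) (fun X Y Z g f => erefl).

Section CompFunctor.
Variables (C D E : category) (G : functor D E) (F : functor C D).

Fact comp_fmap1 (X : C) : fmap G (fmap F (idm X)) = idm (G (F X)).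
Proof. by rewrite !fmap1. Qed.

Fact comp_fmapM (X Y Z : C) (g : hom Y Z) (f : hom X Y) :
  fmap G (fmap F (comp g f)) = comp (fmap G (fmap F g)) (fmap G (fmap F f)).
Proof. by rewrite !fmapM. Qed.

Definition comp_functor : functor C E :=
  @Functor C E (fun X => G (F X)) (fun X Y f => fmap G (fmap F f))
    comp_fmap1 comp_fmapM.

End CompFunctor.

(* op (op C) is not convertible to C, so an endofunctor of op C has to be     *)
(* turned explicitly into an endofunctor of C.                                *)
Definition unop_functor (C D : category) (F : functor (op C) (op D)) :
    functor C D :=
  @Functor C D F (fun X Y f => @fmap _ _ F Y X f) (fun X => fmap1 F X)
    (fun X Y Z g f => @fmapM _ _ F Z Y X f g).

Definition natural (C D : category) (F G : functor C D)
    (eta : forall X : C, hom (F X) (G X)) : Prop :=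
  forall (X Y : C) (f : hom X Y),
    comp (eta Y) (fmap F f) = comp (fmap G f) (eta X).

Arguments natural {C D} F G eta.

(* F is left adjoint to G with unit eta and counit eps.                       *)
Definition adjoint_situation (C D : category) (F : functor C D)
    (G : functor D C) (eta : forall X : C, hom X (G (F X)))
    (eps : forall Y : D, hom (F (G Y)) Y) : Prop :=
  [/\ natural (id_functor C) (comp_functor G F) eta,
      natural (comp_functor F G) (id_functor D) eps,
      forall X : C, comp (eps (F X)) (fmap F (eta X)) = idm (F X) &
      forall Y : D, comp (fmap G (eps Y)) (eta (G Y)) = idm (G Y)].

Arguments adjoint_situation {C D} F G eta eps.

HB.mixin Record POrder_hasAllJoins d T of Order.POrder d T := {
  ex_isLub : forall A : set T, exists m, isLub A m }.

#[short(type="supSemilatticeType")]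
HB.structure Definition SupSemilattice d :=
  {T of POrder_hasAllJoins d T & Order.POrder d T}.

Definition lub d (G : supSemilatticeType d) (A : set G) : G :=
  projT1 (cid (ex_isLub A)).

Lemma lubP d (G : supSemilatticeType d) (A : set G) : isLub A (lub A).
Proof. exact: projT2 (cid (ex_isLub A)). Qed.

Lemma lub_ub d (G : supSemilatticeType d) (A : set G) x : A x -> x <= lub A.
Proof. by have [+ _] := lubP A; apply. Qed.

Lemma lub_le d (G : supSemilatticeType d) (A : set G) b :
  (forall x, A x -> x <= b) -> lub A <= b.
Proof. by have [_ +] := lubP A; apply. Qed.

Lemma isLub_lub d (G : supSemilatticeType d) (A : set G) m :
  isLub A m -> lub A = m.
Proof.
move=> [mA Am]; apply/le_anti/andP; split; first exact: lub_le.
by apply: Am => x; exact: lub_ub.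
Qed.

Fact fun_isLub (aT : Type) d (L : supSemilatticeType d) (A : set (aT -> L)) :
  isLub A (fun i => lub [set x i | x in A]).
Proof.
split=> [x Ax|b Ab]; apply/lefP => i; first by apply: lub_ub; exists x.
by apply: lub_le => _ [x Ax <-]; apply: (lefP _ _ (Ab x Ax)).
Qed.

HB.instance Definition _ (aT : Type) d (L : supSemilatticeType d) :=
  POrder_hasAllJoins.Build _ (aT -> L)
    (fun A => ex_intro _ _ (@fun_isLub aT d L A)).

Lemma lub_funE (aT : Type) d (L : supSemilatticeType d) (A : set (aT -> L)) i :
  lub A i = lub [set x i | x in A].
Proof. by rewrite (isLub_lub (fun_isLub A)). Qed.

Definition preserves_joins d d' (G : supSemilatticeType d)
    (H : supSemilatticeType d') (f : G -> H) : Prop :=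
  forall A : set G, f (lub A) = lub (f @` A).

Record sup_hom d d' (G : supSemilatticeType d) (H : supSemilatticeType d') :=
  SupHom { sup_fun :> G -> H ; sup_homP : preserves_joins sup_fun }.

Lemma sup_hom_eq d d' (G : supSemilatticeType d) (H : supSemilatticeType d')
  (f g : sup_hom G H) : f =1 g -> f = g.
Proof.
case: f g => [f fP] [g gP] /= /funext fg.
by rewrite fg in fP *; rewrite (Prop_irrelevance fP gP).
Qed.

Lemma sup_hom_mono d d' (G : supSemilatticeType d) (H : supSemilatticeType d')
  (f : sup_hom G H) x y : x <= y -> f x <= f y.
Proof.
move=> xy; have -> : y = lub [set x; y].
  apply/esym/isLub_lub; split; first by move=> _ [] ->.
  by move=> b; apply; right.
by rewrite (sup_homP f); apply: lub_ub; exists x => //; left.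
Qed.

Fact id_preserves_joins d (G : supSemilatticeType d) :
  preserves_joins (fun x : G => x).
Proof. by move=> A; rewrite image_id. Qed.

Definition sup_id d (G : supSemilatticeType d) : sup_hom G G :=
  SupHom (@id_preserves_joins d G).

Section SupComp.
Variables (d1 d2 d3 : Order.disp_t) (G1 : supSemilatticeType d1).
Variables (G2 : supSemilatticeType d2) (G3 : supSemilatticeType d3).
Variables (g : sup_hom G2 G3) (f : sup_hom G1 G2).

Fact comp_preserves_joins : preserves_joins (fun x => g (f x)).
Proof. by move=> A; rewrite (sup_homP f) (sup_homP g) image_comp. Qed.

Definition sup_comp : sup_hom G1 G3 := SupHom comp_preserves_joins.

End SupComp.

(* Objects of F-S_<=; the display is packed because it only steers notations. *)
Record fsup := FSup {
  fsup_disp : Order.disp_t ;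
  fsup_sort :> supSemilatticeType fsup_disp ;
  fsup_op : sup_hom fsup_sort fsup_sort }.

Arguments fsup_op : clear implicits.

Record lax_hom (H1 H2 : fsup) := LaxHom {
  lax_sup_hom :> sup_hom H1 H2 ;
  lax_homP : forall x, fsup_op H2 (lax_sup_hom x) <= lax_sup_hom (fsup_op H1 x) }.

Lemma lax_hom_eq (H1 H2 : fsup) (f g : lax_hom H1 H2) : f =1 g -> f = g.
Proof.
case: f g => [f fP] [g gP] /= /sup_hom_eq fg.
by rewrite fg in fP *; rewrite (Prop_irrelevance fP gP).
Qed.

Definition lax_id (H : fsup) : lax_hom H H :=
  @LaxHom H H (sup_id H) (fun x => lexx _).

Section LaxComp.
Variables (H1 H2 H3 : fsup) (g : lax_hom H2 H3) (f : lax_hom H1 H2).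

Fact lax_compP x :
  fsup_op H3 (sup_comp g f x) <= sup_comp g f (fsup_op H1 x).
Proof. exact: le_trans (lax_homP g _) (sup_hom_mono g (lax_homP f x)). Qed.

Definition lax_comp : lax_hom H1 H3 := LaxHom lax_compP.

End LaxComp.

Fact lax_comp1m (H1 H2 : fsup) (f : lax_hom H1 H2) :
  lax_comp (lax_id H2) f = f.
Proof. exact: lax_hom_eq. Qed.

Fact lax_compm1 (H1 H2 : fsup) (f : lax_hom H1 H2) :
  lax_comp f (lax_id H1) = f.
Proof. exact: lax_hom_eq. Qed.

Fact lax_compA (H1 H2 H3 H4 : fsup) (h : lax_hom H3 H4) (g : lax_hom H2 H3)
    (f : lax_hom H1 H2) :
  lax_comp h (lax_comp g f) = lax_comp (lax_comp h g) f.
Proof. exact: lax_hom_eq. Qed.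

Definition fsup_category : category :=
  Category lax_comp1m lax_compm1 lax_compA.

(* Frames in the sense of Kripke semantics, not of pointfree topology.        *)
Record frame := Frame {
  frame_sort :> Type ;
  frame_rel : frame_sort -> frame_sort -> Prop }.

Arguments frame_rel : clear implicits.

Record frame_hom (J1 J2 : frame) := FrameHom {
  frame_fun :> J1 -> J2 ;
  frame_homP : forall i j,
    frame_rel J1 i j -> frame_rel J2 (frame_fun i) (frame_fun j) }.

Lemma frame_hom_eq (J1 J2 : frame) (s t : frame_hom J1 J2) : s =1 t -> s = t.
Proof.
case: s t => [s sP] [t tP] /= /funext st.
by rewrite st in sP *; rewrite (Prop_irrelevance sP tP).
Qed.

Definition frame_id (J : frame) : frame_hom J J :=
  @FrameHom J J (fun i => i) (fun i j ij => ij).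

Definition frame_comp (J1 J2 J3 : frame) (t : frame_hom J2 J3)
    (s : frame_hom J1 J2) : frame_hom J1 J3 :=
  @FrameHom J1 J3 (fun i => t (s i))
    (fun i j ij => frame_homP t (frame_homP s ij)).

Fact frame_comp1m (J1 J2 : frame) (t : frame_hom J1 J2) :
  frame_comp (frame_id J2) t = t.
Proof. exact: frame_hom_eq. Qed.

Fact frame_compm1 (J1 J2 : frame) (t : frame_hom J1 J2) :
  frame_comp t (frame_id J1) = t.
Proof. exact: frame_hom_eq. Qed.

Fact frame_compA (J1 J2 J3 J4 : frame) (u : frame_hom J3 J4)
    (t : frame_hom J2 J3) (s : frame_hom J1 J2) :
  frame_comp u (frame_comp t s) = frame_comp (frame_comp u t) s.
Proof. exact: frame_hom_eq. Qed.

Definition frame_category : category :=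
  Category frame_comp1m frame_compm1 frame_compA.

Section Power.
Variables (d : Order.disp_t) (L : supSemilatticeType d).

Definition power_op (J : frame) (x : J -> L) : J -> L :=
  fun i => lub [set x k | k in frame_rel J i].

Fact power_op_preserves_joins (J : frame) : preserves_joins (@power_op J).
Proof.
move=> A; apply/esym/isLub_lub; split.
  move=> _ [x Ax <-]; apply/lefP => i; apply: lub_le => _ [k ik <-].
  rewrite (@le_trans _ _ (lub A k))//; first exact: (lefP _ _ (lub_ub Ax)).
  by apply: lub_ub; exists k.
move=> b Ab; apply/lefP => i; apply: lub_le => _ [k ik <-].
rewrite lub_funE; apply: lub_le => _ [x Ax <-].
apply: (@le_trans _ _ (power_op x i)); first by apply: lub_ub; exists k.
by apply: (lefP _ _ _ i); apply: Ab; exists x.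
Qed.

Definition power (J : frame) : fsup :=
  FSup (SupHom (@power_op_preserves_joins J)).

Section PowerMap.
Variables (J1 J2 : frame) (t : frame_hom J1 J2).

Definition power_fun (x : J2 -> L) : J1 -> L := fun i => x (t i).

Fact power_fun_preserves_joins : preserves_joins power_fun.
Proof.
move=> A; apply/funext => i; rewrite /power_fun !lub_funE; congr lub.
by rewrite image_comp.
Qed.

Definition power_sup_hom : sup_hom (power J2) (power J1) :=
  SupHom power_fun_preserves_joins.

Fact power_map_lax (x : power J2) :
  fsup_op (power J1) (power_sup_hom x) <= power_sup_hom (fsup_op (power J2) x).
Proof.
apply/lefP => i; apply: lub_le => _ [k ik <-]; apply: lub_ub.
by exists (t k) => //; apply: frame_homP.
Qed.

Definition power_map : lax_hom (power J2) (power J1) := LaxHom power_map_lax.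

End PowerMap.

Fact power_map1 (J : frame) : power_map (frame_id J) = lax_id (power J).
Proof. exact: lax_hom_eq. Qed.

Fact power_mapM (J1 J2 J3 : frame) (t : frame_hom J2 J3)
    (s : frame_hom J1 J2) :
  power_map (frame_comp t s) = lax_comp (power_map s) (power_map t).
Proof. exact: lax_hom_eq. Qed.

Definition power_functor : functor frame_category (op fsup_category) :=
  @Functor frame_category (op fsup_category) power power_map
    power_map1 power_mapM.

Definition hom_frame (H : fsup) : frame :=
  @Frame (sup_hom H L) (fun alpha beta => forall x, beta x <= alpha (fsup_op H x)).

Section HomFrameMap.
Variables (H1 H2 : fsup) (f : lax_hom H1 H2).

Fact hom_frame_mapP (alpha beta : hom_frame H2) :
  frame_rel (hom_frame H2) alpha beta ->
  frame_rel (hom_frame H1) (sup_comp alpha f) (sup_comp beta f).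
Proof.
move=> ab x; apply: (le_trans (ab (f x))).
exact: (sup_hom_mono alpha (lax_homP f x)).
Qed.

Definition hom_frame_map : frame_hom (hom_frame H2) (hom_frame H1) :=
  FrameHom hom_frame_mapP.

End HomFrameMap.

Fact hom_frame_map1 (H : fsup) :
  hom_frame_map (lax_id H) = frame_id (hom_frame H).
Proof. by apply: frame_hom_eq => alpha; exact: sup_hom_eq. Qed.

Fact hom_frame_mapM (H1 H2 H3 : fsup) (f : lax_hom H1 H2)
    (g : lax_hom H2 H3) :
  hom_frame_map (lax_comp g f)
  = frame_comp (hom_frame_map f) (hom_frame_map g).
Proof. by apply: frame_hom_eq => alpha; exact: sup_hom_eq. Qed.

Definition hom_frame_functor : functor (op fsup_category) frame_category :=
  @Functor (op fsup_category) frame_category hom_frame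
    (fun H2 H1 f => hom_frame_map f)
    hom_frame_map1 (fun H3 H2 H1 f g => hom_frame_mapM f g).

End Power.

(* Main.v *)
Require Import Defs.
From mathcomp Require Import all_boot all_order.
From mathcomp Require Import boolp classical_sets.

(* Both transformations are evaluation maps, [i |-> (x |-> x i)] and           *)
(* [x |-> (alpha |-> alpha x)], so naturality and the triangle identities hold *)
(* by computation once morphisms are compared pointwise. The order is only     *)
(* used to see that the evaluations are morphisms: [x k <= F^J x i] whenever   *)
(* [S i k], and [F^J] of the evaluation at [x], taken at [alpha], is the join  *)
(* of the [beta x] over the [beta] with [S alpha beta], each of which is       *)
(* below [alpha (F x)].                                                        *)

Import Order.TTheory.
Local Open Scope classical_set_scope.
Local Open Scope order_scope.

Section Evaluation.
Context {d : Order.disp_t} (L : supSemilatticeType d).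

Section Unit.
Variable J : frame.

Lemma eval_at_preserves_joins (i : J) :
  preserves_joins (fun x : power L J => x i).
Proof. by move=> A; exact: lub_funE. Qed.

Definition eval_at (i : J) : sup_hom (power L J) L :=
  SupHom (eval_at_preserves_joins i).

Lemma eval_at_rel (i j : J) : frame_rel J i j ->
  frame_rel (hom_frame L (power L J)) (eval_at i) (eval_at j).
Proof. by move=> ij x; apply: lub_ub; exists j. Qed.

Definition frame_unit : frame_hom J (hom_frame L (power L J)) :=
  FrameHom eval_at_rel.

(** The formula fixes every value [h i x], and both frame homomorphisms and sup-morphisms are
    determined by their values. *)
Lemma frame_unit_unique :
  unique (fun h : frame_hom J (hom_frame L (power L J)) =>
            forall (x : J -> L) (i : J), h i x = x i) frame_unit.
Proof.
split=> // h hE; apply: frame_hom_eq => i; apply: sup_hom_eq => x.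
by rewrite hE.
Qed.

End Unit.

Section Counit.
Variable H : fsup.

Definition eval_fun (x : H) : power L (hom_frame L H) :=
  fun alpha => alpha x.

(** Joins in a power are pointwise, so at [alpha] this is preservation of joins by [alpha]
    itself. *)
Lemma eval_fun_preserves_joins : preserves_joins eval_fun.
Proof.
move=> A; apply/funext => alpha.
by rewrite lub_funE image_comp; exact: (sup_homP alpha).
Qed.

Lemma eval_fun_lax (x : H) :
  fsup_op (power L (hom_frame L H)) (SupHom eval_fun_preserves_joins x)
  <= SupHom eval_fun_preserves_joins (fsup_op H x).
Proof. by apply/lefP => alpha; apply: lub_le => _ [beta ab <-]; exact: ab. Qed.

(** Read in [op fsup_category], this points from the power to [H]: it is the counit. *)
Definition fsup_unit : lax_hom H (power L (hom_frame L H)) :=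
  LaxHom eval_fun_lax.

End Counit.

(** Along [t], both composites send [i] to the map taking [x] to [x (t i)]. *)
Lemma frame_unit_natural :
  natural (id_functor frame_category)
    (comp_functor (hom_frame_functor L) (power_functor L)) frame_unit.
Proof.
by move=> J1 J2 t; apply: frame_hom_eq => i; exact: sup_hom_eq.
Qed.

Lemma fsup_unit_natural :
  natural (id_functor fsup_category)
    (unop_functor (comp_functor (power_functor L) (hom_frame_functor L)))
    fsup_unit.
Proof. by move=> H1 H2 f; exact: lax_hom_eq. Qed.

Lemma eval_adjoint_situation :
  adjoint_situation (power_functor L) (hom_frame_functor L)
    frame_unit fsup_unit.
Proof.
split; first exact: frame_unit_natural.
(* Passing to the opposite category reverses [f] and exchanges the two sides of the square. *)
- by move=> H2 H1 f; apply/esym; exact: fsup_unit_natural.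
- by move=> J; exact: lax_hom_eq.
(* Evaluation at [alpha], precomposed with [fsup_unit H], is [alpha] again. *)
- by move=> H; apply: frame_hom_eq => alpha; exact: sup_hom_eq.
Qed.

End Evaluation.

Theorem theorem4p3 (d : Order.disp_t) (L : supSemilatticeType d) :
  exists (nu : forall J : frame, frame_hom J (hom_frame L (power L J)))
         (mu : forall H : fsup, lax_hom H (power L (hom_frame L H))),
  [/\ (forall J : frame,
         unique (fun h : frame_hom J (hom_frame L (power L J)) =>
                   forall (x : J -> L) (i : J), h i x = x i) (nu J)) /\
      natural (id_functor frame_category)
              (comp_functor (hom_frame_functor L) (power_functor L)) nu,
      (forall (H : fsup) (x : H) (alpha : hom_frame L H),
         mu H x alpha = alpha x) /\
      natural (id_functor fsup_category)
              (unop_functor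
                 (comp_functor (power_functor L) (hom_frame_functor L))) mu &
      adjoint_situation (power_functor L) (hom_frame_functor L) nu mu].
Proof.
exists (frame_unit L), (fsup_unit L); split.
- by split; [exact: frame_unit_unique | exact: frame_unit_natural].
- by split; [|exact: fsup_unit_natural].
- exact: eval_adjoint_situation.
Qed.
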